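(* The nontrivial MDS codes over $\mathbb{F}_q$ for $q\in\{2,3,4\}$ are classified, up to equivalence, as follows. (a) There are no nontrivial MDS codes over $\mathbb{F}_2$. (b) The only nontrivial MDS code over $\mathbb{F}_3$ is the ternary Hamming $[4,2,3]_3$ code, which is self-dual. (c) The nontrivial MDS codes over $\mathbb{F}_4$ are the following four: the Hamming $[5,3,3]_4$ code, its dual the simplex $[5,2,4]_4$ code, a self-dual $[4,2,3]_4$ code, and the $[6,3,4]_4$ hexacode.
   Context: $\mathbb{F}_q$ is the finite field of order $q$. An $[n,k,d]_q$ code $C$ is a $k$-dimensional linear subspace of $\mathbb{F}_q^n$ with minimum Hamming distance $d$. $C$ is MDS if $d=n-k+1$; an MDS $[n,k,d]_q$ code is nontrivial if $2\le k\le n-2$. Two linear codes in $\mathbb{F}_q^n$ are equivalent if one is the image of the other under a monomial transformation (a permutation of coordinates together with multiplication of coordinates by nonzero scalars). The dual is $C^\perp=\{\mathbf{x}\in\mathbb{F}_q^n : \mathbf{x}\cdot\mathbf{v}=0\ \forall \mathbf{v}\in C\}$ for the Euclidean inner product $\mathbf{v}\cdot\mathbf{u}=\sum_{i=1}^n v_iu_i$, and $C$ is self-dual if $C=C^\perp$. Hamming codes are the linear perfect codes with packing radius $\lfloor (d-1)/2\rfloor=1$; they have parameters $[n,n-m,3]_q$ with $n=(q^m-1)/(q-1)$, $m\ge2$, and their duals are the simplex codes, with parameters $[n,m,q^{m-1}]_q$. The hexacode is the well-known two-weight $[6,3,4]_4$ code. *)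

(* Defs.v *)
From HB Require Import structures.
From mathcomp Require Import all_boot all_order all_fingroup all_algebra.

Set Implicit Arguments.
Unset Strict Implicit.
Unset Printing Implicit Defensive.

Import GRing.Theory.
Local Open Scope ring_scope.

Section Codes.
Variable F : finFieldType.

Definition hdist n (x y : 'rV[F]_n) : nat := #|[set i | x 0 i != y 0 i]|.

Definition hweight n (x : 'rV[F]_n) : nat := hdist x 0.

(* No distance exceeds n, so the unit n of the iterated minimum only matters
   for the zero code, which has no pair of distinct codewords. *)
Definition min_dist n (C : {vspace 'rV[F]_n}) : nat :=
  \big[minn/n]_(p : 'rV[F]_n * 'rV[F]_n
                | [&& p.1 \in C, p.2 \in C & p.1 != p.2]) hdist p.1 p.2.

(* C is an [n, k, d]_q code, where n is the length of the vectors in the type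
   of C and q = #|F|. *)
Definition code_params n (C : {vspace 'rV[F]_n}) (k d : nat) : Prop :=
  \dim C = k /\ min_dist C = d.

(* \dim C <= n always holds, so the subtraction is not truncated. *)
Definition MDS n (C : {vspace 'rV[F]_n}) : Prop :=
  min_dist C = (n - \dim C + 1)%N.

Definition nontrivial_MDS n (C : {vspace 'rV[F]_n}) : Prop :=
  MDS C /\ (2 <= \dim C <= n - 2)%N.

Definition monomial_map n (s : 'S_n) (a : 'I_n -> F) (x : 'rV[F]_n)
  : 'rV[F]_n := \row_i (a i * x 0 (s i)).

Definition monomially_equivalent n (C D : {vspace 'rV[F]_n}) : Prop :=
  exists (s : 'S_n) (a : 'I_n -> F),
    (forall i, a i != 0) /\
    (forall y, y \in D <-> exists2 x, x \in C & y = monomial_map s a x).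

(* Equivalence of codes whose lengths are not known to agree: the lengths are
   equal and, after transport, the codes are monomially equivalent. *)
Definition equivalent m n (C : {vspace 'rV[F]_m}) (D : {vspace 'rV[F]_n})
  : Prop :=
  exists e : m = n,
    monomially_equivalent (ecast i {vspace 'rV[F]_i} e C) D.

Definition dotp n (x v : 'rV[F]_n) : F := \sum_i x 0 i * v 0 i.

Definition dual n (C : {vspace 'rV[F]_n}) : {vspace 'rV[F]_n} :=
  (\bigcap_(v : 'rV[F]_n | v \in C) lker (linfun (fun x => dotp x v : F^o)))%VS.

Lemma mem_dual n (C : {vspace 'rV[F]_n}) (x : 'rV[F]_n) :
  x \in dual C <-> (forall v, v \in C -> dotp x v = 0).
Proof.
have kerE v : (x \in lker (linfun (fun x => dotp x v : F^o))) =
              (dotp x v == 0).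
  have lin : linear (fun x : 'rV[F]_n => dotp x v : F^o).
    move=> c y z; rewrite /dotp scaler_sumr -big_split.
    by apply: eq_bigr => i _; rewrite !mxE mulrDl -mulrA.
  pose f : {linear 'rV[F]_n -> F^o} :=
    HB.pack (fun x : 'rV[F]_n => dotp x v : F^o)
      (GRing.isLinear.Build F 'rV[F]_n F^o *:%R _ lin).
  by rewrite memv_ker (lfunE f).
split.
- move=> xD v vC; apply/eqP; rewrite -kerE.
  have sub : (dual C <= lker (linfun (fun x => dotp x v : F^o)))%VS.
    by rewrite /dual (bigD1 v) //= capvSl.
  exact: (subvP sub).
- move=> x0; rewrite memvE; apply/subv_bigcapP => v vC.
  by rewrite -memvE kerE x0.
Qed.

Definition self_dual n (C : {vspace 'rV[F]_n}) : Prop := C = dual C.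

Definition packing_radius n (C : {vspace 'rV[F]_n}) : nat :=
  ((min_dist C - 1) %/ 2)%N.

(* The balls of radius packing_radius C around the codewords partition the
   whole space. *)
Definition perfect n (C : {vspace 'rV[F]_n}) : Prop :=
  forall x : 'rV[F]_n,
    exists! c : 'rV[F]_n, c \in C /\ (hdist x c <= packing_radius C)%N.

Definition hamming_code n (C : {vspace 'rV[F]_n}) : Prop :=
  perfect C /\ packing_radius C = 1%N.

Definition simplex_code n (C : {vspace 'rV[F]_n}) : Prop :=
  exists2 H : {vspace 'rV[F]_n}, hamming_code H & C = dual H.

(* The nonzero codewords take exactly two Hamming weights. *)
Definition two_weight n (C : {vspace 'rV[F]_n}) : Prop :=
  exists w1 w2 : nat, w1 <> w2 /\
    forall w : nat,
      (exists2 x, x \in C & x != 0 /\ hweight x = w) <-> w = w1 \/ w = w2.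

Definition row_of_seq n (s : seq F) : 'rV[F]_n := \row_i s`_i.

(* The words (a, b, c, f(1), f(w), f(w^2)) with f(x) = a x^2 + b x + c, where
   F = {0, 1, w, w^2}; the spanning words are those of f = x^2, x and 1
   (note that (w^2)^2 = w). *)
Definition hexacode_at (w : F) : {vspace 'rV[F]_6} :=
  <<[:: row_of_seq 6 [:: 1; 0; 0; 1; w ^+ 2; w];
        row_of_seq 6 [:: 0; 1; 0; 1; w; w ^+ 2];
        row_of_seq 6 [:: 0; 0; 1; 1; 1; 1]]%R>>%VS.

(* Either root w of X^2 + X + 1 in F_4 may be used; the two resulting codes
   are equivalent. *)
Definition hexacode (C : {vspace 'rV[F]_6}) : Prop :=
  exists2 w : F, w ^+ 2 + w + 1 = 0 & C = hexacode_at w.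

End Codes.

(* Main.v *)
Require Import Defs.
From HB Require Import structures.
From mathcomp Require Import all_boot all_order all_fingroup all_algebra.
From mathcomp Require Import all_field ring zify.

(** A nonzero word of an MDS code of dimension k has fewer than k zeros, so the
    code takes arbitrary values on any k coordinates (MDS_interpolation).
    Applied to the first k coordinates, this puts an MDS code of dimension k
    and length k + r in systematic form { (x, xA) } with no permutation of the
    coordinates (MDS_syscode), and the entries and 2 x 2 minors of the k x r
    matrix A are nonzero (MDS_small_minors). Divide A by its first row and
    column. For k, r >= 2, the entries in any other row are then distinct and
    nonzero, and likewise in columns, so that k and r are less than q
    (small_minors_ltn_card): nothing remains for q = 2, only k = r = 2 for
    q = 3, and only k, r in {2, 3} for q = 4.

    When q <= 4, the entries outside the first row and column avoid 0 and 1,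
    hence take at most two values, and the entry in position (1, 1) fixes all
    the others (eq_normalized). If two matrices differ in that entry, its two
    values are inverse to each other, and exchanging the first two columns of
    one matrix makes them agree. So all nontrivial MDS codes with given k and
    r are equivalent (MDS_unique), and the classification reduces to producing
    one code of each kind.

    For two check symbols, nonzero entries and 2 x 2 minors conversely imply
    MDS (small_minors_MDS), and k = q - 1 then gives a perfect code, because
    the q + 1 columns of the parity-check matrix represent all the points of
    the projective line (syscode_perfect). This yields the two Hamming codes
    and the self-dual [4,2,3] code. The simplex code is MDS because duality
    preserves MDS codes (MDS_dual_weight). The hexacode is the extension of the
    quaternary [5,3,3] code by one symbol that makes all weights even: the
    cubes of the symbols of a word, each equal to 0 or 1, sum to 0. Its nonzero
    weights, at least 3 and even, are therefore 4 and 6 (hweight_hexacode). *)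

Set Implicit Arguments.
Unset Strict Implicit.
Unset Printing Implicit Defensive.

Import GRing.Theory.

(** * Weights and minimum distance *)

Section Weight.
Local Open Scope ring_scope.
Variable F : finFieldType.

Lemma hdistE n (x y : 'rV[F]_n) : hdist x y = hweight (x - y).
Proof.
by apply: eq_card => i; rewrite !inE !mxE subr_eq0.
Qed.

Lemma hweightE n (x : 'rV[F]_n) : hweight x = (\sum_i (x 0 i != 0)%R)%N.
Proof.
rewrite /hweight /hdist -sum1_card big_mkcond /=.
by apply: eq_bigr => i _; rewrite inE mxE; case: (_ != _).
Qed.

Lemma hweight0 n : hweight (0 : 'rV[F]_n) = 0%N.
Proof. by rewrite hweightE big1 // => i _; rewrite mxE eqxx. Qed.

Lemma hweight_row_mx k r (x : 'rV[F]_k) (z : 'rV[F]_r) :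
  hweight (row_mx x z) = (hweight x + hweight z)%N.
Proof.
rewrite !hweightE big_split_ord /=.
by congr (_ + _)%N; apply: eq_bigr => i _; rewrite ?row_mxEl ?row_mxEr.
Qed.

Lemma hweight_zeros n (x : 'rV[F]_n) :
  (hweight x + #|[set i | (x 0 i == 0)%R]|)%N = n.
Proof.
rewrite -[RHS]card_ord -(cardsC [set i | (x 0 i != 0)%R]); congr (_ + _)%N.
  by apply: eq_card => i; rewrite !inE mxE.
by apply: eq_card => i; rewrite !inE negbK.
Qed.

Lemma hweight_leq n (x : 'rV[F]_n) (S : {set 'I_n}) :
  (forall i, i \notin S -> x 0 i = 0) -> (hweight x <= #|S|)%N.
Proof.
move=> x0; apply/subset_leq_card/subsetP => i; rewrite inE mxE.
by apply: contraR => /x0 ->.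
Qed.

Lemma hweight_leq_zeros n (x : 'rV[F]_n) (S : {set 'I_n}) :
  (forall i, i \in S -> x 0 i = 0) -> (hweight x + #|S| <= n)%N.
Proof.
move=> x0; rewrite -[leqRHS](hweight_zeros x) leq_add2l.
by apply/subset_leq_card/subsetP => i /x0; rewrite inE => ->.
Qed.

Lemma hdist_triangle n (x y z : 'rV[F]_n) :
  (hdist x z <= hdist y x + hdist y z)%N.
Proof.
rewrite /hdist; apply: leq_trans (leq_card_setU _ _).1.
apply/subset_leq_card/subsetP => i; rewrite !inE.
by apply: contraR; rewrite negb_or !negbK => /andP[/eqP <- /eqP <-].
Qed.

Lemma min_dist_leq n (C : {vspace 'rV[F]_n}) x :
  x \in C -> x != 0 -> (min_dist C <= hweight x)%N.
Proof.
move=> xC x0; rewrite /min_dist -minEnat -leEnat.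
by apply: (@Order.TotalTheory.bigmin_inf _ _ _ _ (x, 0)); rewrite //= xC mem0v.
Qed.

Lemma leq_min_dist n (C : {vspace 'rV[F]_n}) d :
  (d <= n)%N -> (forall x, x \in C -> x != 0 -> (d <= hweight x)%N) ->
  (d <= min_dist C)%N.
Proof.
move=> dn dC; apply: (big_ind (fun m => d <= m)%N) => //.
  by move=> a b da db; rewrite leq_min da.
case=> x y /= /and3P[xC yC xy]; rewrite hdistE.
by apply: dC; rewrite ?rpredB // subr_eq0.
Qed.

(** Dimension count: restricting a code of dimension k to fewer than k
    coordinates has a nonzero kernel. *)
Lemma singleton_word n (C : {vspace 'rV[F]_n}) : (0 < \dim C)%N ->
  exists x, [/\ x \in C, x != 0 & (hweight x <= n - \dim C + 1)%N].
Proof.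
move=> C0; have kn : (\dim C <= n)%N.
  by rewrite -[leqRHS]mul1n -[leqRHS](dim_matrix F 1) -dimvf dimvS ?subvf.
have [k kE] : {k | \dim C = k.+1 :> nat} by exists (\dim C).-1; rewrite prednK.
have kn' : (k <= n)%N by lia.
pose f : 'Hom('rV[F]_n, 'rV[F]_k) := linfun (colsub (widen_ord kn')).
have imk : (\dim (f @: C) <= k)%N.
  by rewrite -[leqRHS]mul1n -[leqRHS](dim_matrix F 1) -dimvf dimvS ?subvf.
have dimE := limg_ker_dim f C.
have ker0 : (C :&: lker f)%VS != 0%VS.
  rewrite -dimv_eq0; apply/eqP => d0; move: dimE imk.
  by rewrite d0 kE add0n => ->; rewrite ltnn.
have := memv_pick (C :&: lker f)%VS; rewrite memv_cap => /andP[xC].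
rewrite memv_ker lfunE /= => /eqP x0.
exists (vpick (C :&: lker f)%VS); split=> //; first by rewrite vpick0.
rewrite -(leq_add2r k).
have -> : (n - \dim C + 1 + k = n)%N by lia.
rewrite -[X in (_ + X <= _)%N](card_ord k).
have inj : injective (widen_ord kn') by move=> i j /(congr1 val) /= /val_inj.
rewrite -(card_imset _ inj).
apply: hweight_leq_zeros => _ /imsetP[i _ ->].
by move/rowP: x0 => /(_ i); rewrite !mxE.
Qed.

Lemma MDSP n (C : {vspace 'rV[F]_n}) : (0 < \dim C)%N ->
  MDS C <-> (forall x, x \in C -> x != 0 -> (n - \dim C < hweight x)%N).
Proof.
move=> C0; have [y [yC y0 yw]] := singleton_word C0.
split=> [CM x xC x0|CM].
  by move: (min_dist_leq xC x0); rewrite CM addn1.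
apply/eqP; rewrite eqn_leq (leq_trans (min_dist_leq yC y0)) //=.
rewrite addn1; apply: leq_min_dist => //.
by apply: leq_trans (CM _ yC y0) _; rewrite -[leqRHS](hweight_zeros y) leq_addr.
Qed.

(** Since a nonzero word of an MDS code of dimension k has fewer than k zeros,
    restriction to any k coordinates is injective, hence bijective: an MDS
    code takes arbitrary values on any k positions. *)
Lemma MDS_interpolation n k (C : {vspace 'rV[F]_n}) (h : 'I_k -> 'I_n)
    (v : 'rV[F]_k) :
  \dim C = k -> (0 < k)%N -> MDS C -> injective h ->
  exists2 x, x \in C & forall i, x 0 (h i) = v 0 i.
Proof.
move=> dimC k0 CM inj.
pose f : 'Hom('rV[F]_n, 'rV[F]_k) := linfun (colsub h).
have ker0 : (C :&: lker f)%VS = 0%VS.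
  apply/eqP; rewrite -subv0; apply/subvP => x.
  rewrite memv_cap memv_ker lfunE /= memv0 => /andP[xC /eqP x0].
  case: eqP => // /eqP xn0.
  have dC0 : (0 < \dim C)%N by rewrite dimC.
  have := (MDSP dC0).1 CM x xC xn0; rewrite dimC.
  have := @hweight_leq_zeros _ x (h @: 'I_k); rewrite card_imset // card_ord.
  suff z : forall i, i \in h @: 'I_k -> x 0 i = 0 by move/(_ z); lia.
  by move=> _ /imsetP[i _ ->]; move/rowP: x0 => /(_ i); rewrite !mxE.
have /eqP fC : (f @: C)%VS == fullv.
  rewrite eqEdim subvf dimvf (dim_matrix F 1) limg_dim_eq // dimC.
  by apply: eq_leq; rewrite [LHS]mul1n.
have /memv_imgP[x xC vE] : v \in (f @: C)%VS by rewrite fC memvf.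
by exists x => // i; rewrite vE lfunE /= mxE.
Qed.

End Weight.

(** * Systematic codes *)

Section Systematic.
Local Open Scope ring_scope.
Variable F : finFieldType.

Definition syscode k r (A : 'M[F]_(k, r)) : {vspace 'rV[F]_(k + r)} :=
  limg (linfun (mulmxr (row_mx 1%:M A))).

Lemma mem_syscode k r (A : 'M[F]_(k, r)) y :
  (y \in syscode A) = (rsubmx y == lsubmx y *m A).
Proof.
apply/memv_imgP/eqP => [[x _ ->]|yA].
  by rewrite lfunE /= mul_mx_row mulmx1 row_mxKl row_mxKr.
exists (lsubmx y); first exact: memvf.
by rewrite lfunE /= mul_mx_row mulmx1 -yA hsubmxK.
Qed.

Lemma syscode_row k r (A : 'M[F]_(k, r)) x : row_mx x (x *m A) \in syscode A.
Proof. by rewrite mem_syscode row_mxKl row_mxKr. Qed.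

Lemma dim_rowspace k n (C : {vspace 'rV[F]_n}) (G : 'M[F]_(k, n)) B :
  G *m B = 1%:M -> (forall y, y \in C <-> exists x, y = x *m G) ->
  \dim C = k.
Proof.
move=> GB CG.
pose f : 'Hom('rV[F]_k, 'rV[F]_n) := linfun (mulmxr G).
have -> : C = limg f.
  apply/vspaceP => y; apply/idP/memv_imgP => [/CG[x ->]|[x _ ->]].
    by exists x; rewrite ?memvf // lfunE.
  by apply/CG; exists x; rewrite lfunE.
rewrite limg_dim_eq; first by rewrite dimvf (dim_matrix F 1) [LHS]mul1n.
apply/eqP; rewrite -subv0; apply/subvP => x.
rewrite memv_cap memv_ker memvf lfunE /= memv0 => /eqP x0.
by rewrite -[x]mulmx1 -GB mulmxA x0 mul0mx.
Qed.

Lemma dim_syscode k r (A : 'M[F]_(k, r)) : \dim (syscode A) = k.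
Proof.
apply: (@dim_rowspace _ _ _ (row_mx 1%:M A) (col_mx 1%:M 0)).
  by rewrite mul_row_col mulmx1 mulmx0 addr0.
move=> y; split=> [|[x ->]].
  rewrite mem_syscode => /eqP yA; exists (lsubmx y).
  by rewrite mul_mx_row mulmx1 -yA hsubmxK.
by rewrite mul_mx_row mulmx1 syscode_row.
Qed.

(** By interpolation the first k coordinates of an MDS code of dimension k
    determine a codeword and can be prescribed freely, so no permutation of
    coordinates is needed to reach systematic form. *)
Lemma MDS_syscode k r (C : {vspace 'rV[F]_(k + r)}) :
  \dim C = k -> (0 < k)%N -> MDS C -> exists A : 'M[F]_(k, r), C = syscode A.
Proof.
move=> dimC k0 CM.
have wordP (i : 'I_k) : exists x, (x \in C) && (lsubmx x == delta_mx 0 i).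
  have [x xC xE] := MDS_interpolation (delta_mx 0 i) dimC k0 CM (@lshift_inj k r).
  by exists x; rewrite xC; apply/eqP/rowP => j; rewrite mxE xE.
pose w i := xchoose (wordP i).
have wC i : w i \in C by case/andP: (xchooseP (wordP i)).
have wE i : lsubmx (w i) = delta_mx 0 i by case/andP: (xchooseP (wordP i)) => _ /eqP.
exists (\matrix_(i, j) w i 0 (rshift k j)).
set A := \matrix_(_, _) _.
apply/esym/eqP; rewrite eqEdim dim_syscode dimC leqnn andbT.
apply/subvP => y; rewrite mem_syscode => /eqP yA.
suff -> : y = \sum_i y 0 (lshift r i) *: w i.
  by apply: memv_suml => i _; apply: memvZ.
rewrite -[LHS]hsubmxK yA -[RHS]hsubmxK; congr row_mx; apply/rowP => j.
  rewrite !mxE summxE (bigD1 j) //= big1 => [|i ij]; last first.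
    by move/rowP: (wE i) => /(_ j); rewrite !mxE => ->; rewrite eq_sym (negPf ij) mulr0.
  by move/rowP: (wE j) => /(_ j); rewrite !mxE !eqxx => ->; rewrite mulr1 addr0.
by rewrite !mxE summxE; apply: eq_bigr => i _; rewrite !mxE.
Qed.

(** The minors of order 1 and 2 of A; for an MDS code those of all orders are
    nonzero, but these determine the codes over small fields. *)
Definition small_minors_neq0 k r (A : 'M[F]_(k, r)) : Prop :=
  (forall i j, A i j != 0) /\
  (forall i i' j j', i != i' -> j != j' -> A i j * A i' j' != A i j' * A i' j).

Lemma small_minors_tr k r (A : 'M[F]_(k, r)) :
  small_minors_neq0 A -> small_minors_neq0 A^T.
Proof.
case=> A0 A2; split=> [i j|i i' j j' ii jj]; rewrite !mxE //.
by rewrite [X in _ != X]mulrC A2.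
Qed.

(** A vanishing entry or 2 x 2 minor yields a combination of one or two rows
    of the generator matrix with as many zeros as the dimension. *)
Lemma MDS_small_minors k r (A : 'M[F]_(k, r)) :
  (0 < k)%N -> MDS (syscode A) -> small_minors_neq0 A.
Proof.
move=> k0 AM.
have k0' : (0 < \dim (syscode A))%N by rewrite dim_syscode.
have wt x : x != 0 -> (r < hweight x + hweight (x *m A))%N.
  move=> x0; have := (MDSP k0').1 AM _ (syscode_row A x).
  rewrite dim_syscode hweight_row_mx addKn; apply.
  apply: contraNneq x0 => x0; apply/eqP.
  by rewrite -[LHS](row_mxKl x (x *m A)) x0 linear0.
have A0 i j : A i j != 0.
  apply/eqP => z.
  have d0 : delta_mx 0 i != 0 :> 'rV[F]_k.
    by apply/eqP => /rowP/(_ i)/eqP; rewrite !mxE !eqxx oner_eq0.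
  have := wt _ d0; rewrite -rowE.
  have := @hweight_leq F _ (delta_mx 0 i) [set i].
  have := @hweight_leq_zeros F _ (row i A) [set j].
  rewrite !cards1 => w1 w2.
  have {}w1 : (hweight (row i A) + 1 <= r)%N.
    by apply: w1 => l; rewrite inE => /eqP ->; rewrite mxE.
  have {}w2 : (hweight (delta_mx 0%R i : 'rV[F]_k) <= 1)%N.
    by apply: w2 => l; rewrite inE => /negPf li; rewrite mxE li andbF.
  by move/leq_trans/(_ (leq_add w2 (leqnn _))); rewrite ltnNge addnC w1.
split=> // i i' j j' ii jj; apply/eqP => z.
pose x : 'rV[F]_k := A i' j *: delta_mx 0 i - A i j *: delta_mx 0 i'.
have xA l : (x *m A) 0 l = A i' j * A i l - A i j * A i' l.
  by rewrite mulmxBl -!scalemxAl -!rowE !mxE.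
have x0 : x != 0.
  apply/eqP => /rowP/(_ i)/eqP; rewrite !mxE !eqxx (negPf ii).
  by rewrite mulr1 mulr0 subr0 (negPf (A0 _ _)).
have := wt _ x0.
have := @hweight_leq F _ x [set i; i'].
have := @hweight_leq_zeros F _ (x *m A) [set j; j'].
rewrite !cards2 ii jj => w1 w2.
have {}w1 : (hweight (x *m A) + 2 <= r)%N.
  apply: w1 => l; rewrite !inE => /orP[]/eqP ->; rewrite xA.
    by rewrite mulrC subrr.
  by rewrite z mulrC subrr.
have {}w2 : (hweight x <= 2)%N.
  apply: w2 => l; rewrite !inE negb_or => /andP[/negPf li /negPf li'].
  by rewrite !mxE li li' !mulr0 subrr.
by move/leq_trans/(_ (leq_add w2 (leqnn _))); rewrite ltnNge addnC w1.
Qed.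

(** Conversely these minors suffice when there are two check symbols: a
    nonzero message of weight one has two nonzero check symbols, and one of
    weight two has at least one. *)
Lemma small_minors_MDS k (A : 'M[F]_(k, 2)) :
  (0 < k)%N -> small_minors_neq0 A -> MDS (syscode A).
Proof.
move=> k0 [A0 A2]; apply/MDSP; rewrite dim_syscode // => y; rewrite mem_syscode.
rewrite -[y]hsubmxK row_mxKl row_mxKr => /eqP ->.
move: (lsubmx y) => x y0; rewrite hweight_row_mx addKn.
have x0 : hweight x != 0%N.
  apply: contraNneq y0 => /eqP; rewrite cards_eq0 => /eqP/setP x0.
  suff -> : x = 0 by rewrite mul0mx row_mx0.
  by apply/rowP => i; move: (x0 i); rewrite !inE mxE => /negbFE/eqP.
have [x2|x3] := leqP (hweight x) 2; last by rewrite ltn_addr.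
have xE j : (x *m A) 0 j =
    \sum_(i in [set i | x 0 i != (0 : 'rV[F]_k) 0 i]) x 0 i * A i j.
  rewrite mxE [RHS]big_mkcond /=; apply: eq_bigr => i _.
  by rewrite inE mxE; case: eqP => //= ->; rewrite mul0r.
have xE0 : hweight (x *m A) = (((x *m A) 0 0 != 0)%R + ((x *m A) 0 1 != 0)%R)%N.
  rewrite hweightE big_ord_recl big_ord1.
  by have -> : lift ord0 ord0 = 1 :> 'I_2 by apply: val_inj.
rewrite {}xE0 !xE.
have {x0 x2} [wx|wx] : hweight x = 2 \/ hweight x = 1%N.
  by move: x0 x2; case: (hweight x) => [|[|[|]]] //; [right|left].
  have /cards2P[i [i' [ii sE]]] : hdist x 0 == 2 by apply/eqP.
  rewrite wx sE !big_setU1 ?inE //= !big_set1.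
  have xi : x 0 i' != 0 by move/setP: sE => /(_ i'); rewrite !inE mxE eqxx orbT.
  case: (eqVneq (_ + _) 0) => // e0; case: (eqVneq (_ + _) 0) => // e1.
  case/negP: (A2 i i' 0 1 ii isT); rewrite -(inj_eq (mulfI xi)); apply/eqP.
  have {}e0 := addr0_eq e0; have {}e1 := addr0_eq e1.
  by rewrite mulrCA -e1 [RHS]mulrCA -e0; ring.
have /cards1P[i sE] : hdist x 0 == 1%N by apply/eqP.
rewrite wx sE !big_set1 !mulf_eq0 !(negPf (A0 _ _)) !orbF.
by have /setP/(_ i) := sE; rewrite !inE mxE eqxx => ->.
Qed.
End Systematic.

(** * Duals and monomial maps *)

Section Dual.
Local Open Scope ring_scope.
Variable F : finFieldType.

Lemma mem_dual_syscode k r (A : 'M[F]_(k, r)) y :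
  y \in dual (syscode A) <-> lsubmx y = - (rsubmx y *m A^T).
Proof.
have dotE x : dotp y (row_mx x (x *m A)) =
              ((lsubmx y + rsubmx y *m A^T) *m x^T) 0 0.
  have -> v : dotp y v = (y *m v^T) 0 0.
    by rewrite mxE; apply: eq_bigr => i _; rewrite mxE.
  rewrite -[y in LHS]hsubmxK tr_row_mx mul_row_col trmx_mul mulmxA -mulmxDl.
  by [].
rewrite mem_dual; split=> [yD|yA v].
  apply/eqP; rewrite -subr_eq0 opprK; apply/eqP/rowP => i.
  have := yD _ (syscode_row A (delta_mx 0 i)); rewrite dotE trmx_delta.
  by rewrite -colE mxE => ->; rewrite mxE.
rewrite mem_syscode => /eqP vA.
by rewrite -[v]hsubmxK vA dotE yA addNr mul0mx mxE.
Qed.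

Lemma dim_dual_syscode k r (A : 'M[F]_(k, r)) : \dim (dual (syscode A)) = r.
Proof.
apply: (@dim_rowspace _ _ _ _ (row_mx (- A^T) 1%:M) (col_mx 0 1%:M)).
  by rewrite mul_row_col mulmx1 mulmx0 add0r.
move=> y; rewrite mem_dual_syscode; split=> [yA|[x ->]].
  exists (rsubmx y).
  by rewrite mul_mx_row mulmx1 mulmxN -yA hsubmxK.
by rewrite mul_mx_row mulmx1 row_mxKl row_mxKr mulmxN.
Qed.

(** The words (x, xA) and (y, yA) have inner product x (1 + A A^T) y^T. *)
Lemma self_dual_syscode k (A : 'M[F]_k) :
  A *m A^T = - 1%:M -> self_dual (syscode A).
Proof.
move=> AA; have AA' : A^T *m A = - 1%:M.
  by apply: oppr_inj; rewrite opprK -mulmxN; apply: mulmx1C; rewrite mulNmx AA opprK.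
apply/vspaceP => y; apply/idP/idP.
  rewrite mem_syscode mem_dual_syscode => /eqP ->.
  by rewrite -mulmxA AA mulmxN mulmx1 opprK.
rewrite mem_dual_syscode mem_syscode => ->.
by rewrite mulNmx -mulmxA AA' mulmxN mulmx1 opprK.
Qed.

(** If a nonzero word y of the dual had weight at most k = dim C, its support
    would lie in a set of k positions, on which some codeword of C equals 1 at
    one point of the support of y and 0 elsewhere; the two are not
    orthogonal. *)
Lemma MDS_dual_weight n (C : {vspace 'rV[F]_n}) y :
  (0 < \dim C)%N -> MDS C -> y \in dual C -> y != 0 -> (\dim C < hweight y)%N.
Proof.
move=> C0 CM /mem_dual yD y0; rewrite ltnNge; apply/negP => wy.
have kn : (\dim C <= n)%N.
  by rewrite -[leqRHS]mul1n -[leqRHS](dim_matrix F 1) -dimvf dimvS ?subvf.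
(* B consists of n - k zeros of y, so its complement has size k and contains
   the support of y. *)
have [B] : exists B, B \in [set B : {set 'I_n} |
    B \subset [set i | (y 0 i == 0)%R] & #|B| == (n - \dim C)%N].
  apply/card_gt0P; rewrite cards_draws bin_gt0.
  by rewrite leq_subLR -[leqLHS](hweight_zeros y) leq_add2r.
rewrite inE => /andP[/subsetP BZ /eqP cB].
have cS : \dim C = #|~: B|.
  have := cardsC B; rewrite card_ord cB => cE; apply/eqP.
  by rewrite -(eqn_add2l (n - \dim C)) cE subnK.
have [i yi] : exists i, y 0 i != 0.
  by apply/rV0Pn.
have iS : i \in ~: B by rewrite inE; apply: contra yi => /BZ; rewrite inE.
have S0 : (0 < #|~: B|)%N by rewrite -cS.
have [x xC xE] :=
  MDS_interpolation (delta_mx 0 (enum_rank_in iS i)) cS S0 CM enum_val_inj.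
case/negP: yi; move: (yD x xC); rewrite /dotp (bigD1 i) //= big1 => [|l li].
  have := xE (enum_rank_in iS i); rewrite enum_rankK_in // => ->.
  by rewrite mxE !eqxx mulr1 addr0 => ->.
have [lS|lB] := boolP (l \in ~: B); last first.
  by move: lB; rewrite inE negbK => /BZ; rewrite inE => /eqP ->; rewrite mul0r.
have := xE (enum_rank_in iS l); rewrite enum_rankK_in // mxE eqxx /= => ->.
case: eqP => [e|_]; last by rewrite mulr0.
by case/eqP: li; rewrite -(enum_rankK_in iS lS) e enum_rankK_in.
Qed.

End Dual.

(** This allows reindexing the iterated minimum that defines min_dist. *)
HB.instance Definition _ := SemiGroup.isComLaw.Build nat minn minnA minnC.

Section Monomial.
Local Open Scope ring_scope.
Variables (F : finFieldType) (n : nat) (s : 'S_n) (a : 'I_n -> F).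
Implicit Types C D : {vspace 'rV[F]_n}.

Lemma monomial_map_linear : linear (monomial_map s a).
Proof. by move=> c x y; apply/rowP => i; rewrite !mxE mulrDr mulrCA. Qed.

HB.instance Definition _ :=
  GRing.isLinear.Build F 'rV[F]_n 'rV[F]_n *:%R (monomial_map s a)
    monomial_map_linear.

Hypothesis a0 : forall i, a i != 0.

Lemma hdist_monomial_map x y :
  hdist (monomial_map s a x) (monomial_map s a y) = hdist x y.
Proof.
rewrite !hdistE -linearB !hweightE [RHS](reindex_inj (@perm_inj _ s)) /=.
by apply: eq_bigr => i _; rewrite mxE mulf_eq0 (negPf (a0 i)).
Qed.

Lemma monomial_map_inj : injective (monomial_map s a).
Proof.
move=> x y; have := hdist_monomial_map x y => /[swap] ->.
rewrite {1}/hdist => /esym/eqP; rewrite (_ : [set i | _] = set0) ?cards0; last first.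
  by apply/setP => i; rewrite !inE eqxx.
rewrite cards_eq0 => /eqP/setP xy; apply/rowP => i.
by move: (xy i); rewrite !inE => /negbFE/eqP.
Qed.

Lemma monomial_image C D :
  (forall y, y \in D <-> exists2 x, x \in C & y = monomial_map s a x) ->
  \dim C = \dim D /\ min_dist C = min_dist D.
Proof.
move=> DE; have memE x : (monomial_map s a x \in D) = (x \in C).
  by apply/idP/idP => [/DE[x' xC /monomial_map_inj ->]|xC] //; apply/DE; exists x.
split.
  have -> : D = (linfun (monomial_map s a) @: C)%VS.
    apply/vspaceP => y; apply/idP/memv_imgP.
      by case/DE => x xC ->; exists x; rewrite ?lfunE.
    by case=> x xC ->; rewrite lfunE memE.
  rewrite limg_dim_eq //; apply/eqP; rewrite -subv0; apply/subvP => x.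
  rewrite memv_cap memv_ker lfunE memv0 => /andP[_ /eqP x0].
  by apply/eqP/monomial_map_inj; rewrite x0 linear0.
rewrite /min_dist [RHS](reindex_inj (h := fun p : 'rV[F]_n * 'rV[F]_n =>
  (monomial_map s a p.1, monomial_map s a p.2))) /=.
  apply: eq_big => [p|p _]; last by rewrite hdist_monomial_map.
  by rewrite !memE (inj_eq monomial_map_inj).
by case=> x y [x' y'] [/monomial_map_inj -> /monomial_map_inj ->].
Qed.

End Monomial.

Section Equivalent.
Variable F : finFieldType.

Lemma equivalent_params m n (C : {vspace 'rV[F]_m}) (D : {vspace 'rV[F]_n}) :
  equivalent C D -> [/\ m = n, \dim C = \dim D & min_dist C = min_dist D].
Proof.
case=> e; case: _ / e D => D /= [s [a [a0 DE]]].
by have [] := monomial_image a0 DE.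
Qed.

Lemma equivalent_nontrivial m n
    (C : {vspace 'rV[F]_m}) (D : {vspace 'rV[F]_n}) :
  nontrivial_MDS D -> equivalent C D -> nontrivial_MDS C.
Proof.
move=> DM /equivalent_params[mn dimE mdE].
by move: DM; rewrite /nontrivial_MDS /MDS -dimE -mdE; case: _ / mn.
Qed.
End Equivalent.

(** * Uniqueness over fields with at most four elements *)

Section Uniqueness.
Local Open Scope ring_scope.
Variable F : finFieldType.

(** The rows of A are scaled by scaling the message symbols by the inverse
    factors; the columns of A are the check symbols. *)
Lemma syscode_monomial k r (A A' : 'M[F]_(k, r)) (t : 'S_r) a b :
  (forall i, a i != 0) -> (forall j, b j != 0) ->
  (forall i j, A' i j = a i * A i (t j) * b j) ->
  monomially_equivalent (syscode A) (syscode A').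
Proof.
move=> a0 b0 AE.
(* Keep the message positions and permute the check positions by t. *)
pose f i := match split i with inl i => lshift r i | inr j => rshift k (t j) end.
have fl i : f (lshift r i) = lshift r i by rewrite /f (unsplitK (inl i)).
have fr j : f (rshift k j) = rshift k (t j) by rewrite /f (unsplitK (inr j)).
have f_inj : injective f.
  move=> i j; rewrite -[i]splitK -[j]splitK.
  case: (split i) (split j) => [i'|i'] [j'|j'] /=; rewrite ?fl ?fr.
  - by move=> /lshift_inj ->.
  - by move=> /eqP; rewrite eq_lrshift.
  - by move=> /eqP; rewrite eq_rlshift.
  - by move=> /rshift_inj /perm_inj ->.
pose c i := match split i with inl i => (a i)^-1 | inr j => b j end.
have cl i : c (lshift r i) = (a i)^-1 by rewrite /c (unsplitK (inl i)).
have cr j : c (rshift k j) = b j by rewrite /c (unsplitK (inr j)).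
have mapC x : x \in syscode A -> monomial_map (perm f_inj) c x \in syscode A'.
  rewrite !mem_syscode => /eqP xA; apply/eqP/rowP => j.
  rewrite !mxE permE fr cr.
  move/rowP: xA => /(_ (t j)); rewrite !mxE => ->.
  rewrite mulr_sumr; apply: eq_bigr => i _.
  rewrite !mxE permE fl cl AE.
  by field; apply: a0.
exists (perm f_inj), c; split=> [i|y].
  by rewrite /c; case: (split i) => j; rewrite ?invr_eq0.
split=> [yA|[x xA ->]]; last exact: mapC.
pose x := \row_i (a i * lsubmx y 0 i).
exists (row_mx x (x *m A)); first exact: syscode_row.
have := mapC _ (syscode_row A x); move: yA; set z := monomial_map _ _ _.
rewrite !mem_syscode => /eqP yA /eqP zA.
have yz : lsubmx y = lsubmx z.
  apply/rowP => i; rewrite [RHS]mxE [RHS]mxE permE fl cl row_mxEl [x _ _]mxE.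
  by rewrite mulKf.
by rewrite -[y]hsubmxK -[RHS]hsubmxK yA zA yz.
Qed.

(** Otherwise 0, 1, x, y and z would be five distinct elements. *)
Lemma eq_third (x y z : F) : (#|F| <= 4)%N ->
  [/\ x != 0, x != 1 & x != z] -> [/\ y != 0, y != 1 & y != z] ->
  z != 0 -> z != 1 -> x = y.
Proof.
move=> F4 [x0 x1 xz] [y0 y1 yz] z0 z1; apply/eqP; apply: contraLR F4 => xy.
have /card_uniqP U : uniq [:: 0; 1; x; y; z].
  rewrite /= !inE !negb_or xy xz yz !(eq_sym 0) oner_eq0.
  by rewrite !(eq_sym 1) x0 x1 y0 y1 z0 z1.
by rewrite -ltnNge (leq_trans _ (max_card (mem [:: 0; 1; x; y; z]))) ?U.
Qed.

(** The entries of A after the scaling that turns its first row and column into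
    ones; they are invariant under any scaling of the rows and columns. *)
Definition normalized k r (A : 'M[F]_(k.+2, r.+2)) i j : F :=
  A i j * A 0 0 / (A i 0 * A 0 j).

Lemma normalized_neq0 k r (A : 'M[F]_(k.+2, r.+2)) i j :
  small_minors_neq0 A -> normalized A i j != 0.
Proof. by case=> A0 _; rewrite !mulf_neq0 // invr_neq0 ?mulf_neq0. Qed.

Lemma normalized_row0 k r (A : 'M[F]_(k.+2, r.+2)) j :
  small_minors_neq0 A -> normalized A 0 j = 1.
Proof. by case=> A0 _; rewrite /normalized [A 0 j * _]mulrC divff ?mulf_neq0. Qed.

Lemma normalized_col0 k r (A : 'M[F]_(k.+2, r.+2)) i :
  small_minors_neq0 A -> normalized A i 0 = 1.
Proof. by case=> A0 _; rewrite /normalized divff ?mulf_neq0. Qed.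

Lemma normalized_tr k r (A : 'M[F]_(k.+2, r.+2)) i j :
  normalized A^T j i = normalized A i j.
Proof. by rewrite /normalized !mxE [A 0 j * _]mulrC. Qed.

Lemma normalized_inj_row k r (A : 'M[F]_(k.+2, r.+2)) i :
  small_minors_neq0 A -> i != 0 -> injective (normalized A i).
Proof.
case=> A0 A2 i0 j j' /eqP e; apply/eqP; apply: contraTT e => jj.
rewrite /normalized eqr_div ?mulf_neq0 //.
apply: contra (A2 _ _ _ _ i0 jj) => /eqP e; apply/eqP.
have c0 : A 0 0 * A i 0 != 0 by rewrite mulf_neq0.
by apply: (mulfI c0); ring: e.
Qed.

Lemma normalized_inj_col k r (A : 'M[F]_(k.+2, r.+2)) i i' j :
  small_minors_neq0 A -> j != 0 -> i != i' ->
  normalized A i j != normalized A i' j.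
Proof.
move=> /small_minors_tr Am j0 ii; rewrite -!(normalized_tr A).
by rewrite (inj_eq (normalized_inj_row Am j0)).
Qed.

(** In a row of index i != 0 the normalized entries are distinct and nonzero. *)
Lemma small_minors_ltn_card k r (A : 'M[F]_(k.+2, r.+2)) :
  small_minors_neq0 A -> (r.+2 < #|F|)%N.
Proof.
move=> Am; pose f (o : option 'I_r.+2) := if o is Some j then normalized A 1 j else 0.
have f_inj : injective f.
  case=> [j|] [j'|] //=.
  - by move/(normalized_inj_row Am) => ->.
  - by move/eqP; rewrite (negPf (normalized_neq0 _ _ Am)).
  - by move/esym/eqP; rewrite (negPf (normalized_neq0 _ _ Am)).
by have := leq_card f f_inj; rewrite card_option card_ord.
Qed.

(** The normalized entries outside the first row and column avoid 0 and 1, so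
    over a field with at most four elements they take at most two values; as
    they are distinct along rows and columns, one of them fixes them all. *)
Lemma eq_normalized k r (A A' : 'M[F]_(k.+2, r.+2)) : (#|F| <= 4)%N ->
  small_minors_neq0 A -> small_minors_neq0 A' ->
  normalized A 1 1 = normalized A' 1 1 ->
  forall i j, normalized A i j = normalized A' i j.
Proof.
move=> F4 Am Am' e.
have neq1 B i j : small_minors_neq0 B -> i != 0 -> j != 0 ->
    @normalized k r B i j != 1.
  move=> Bm i0 j0; rewrite -(normalized_col0 i Bm).
  by rewrite (inj_eq (normalized_inj_row Bm i0)).
have row1 j : normalized A 1 j = normalized A' 1 j.
  have [->|j0] := eqVneq j 0; first by rewrite !normalized_col0.
  have [->//|j1] := eqVneq j 1.
  apply: (@eq_third _ _ (normalized A 1 1)) => //.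
  - split; rewrite ?normalized_neq0 ?neq1 //.
    by rewrite (inj_eq (normalized_inj_row Am _)).
  - rewrite e; split; rewrite ?normalized_neq0 ?neq1 //.
    by rewrite (inj_eq (normalized_inj_row Am' _)).
  - exact: normalized_neq0.
  - exact: neq1.
move=> i j.
have [->|i0] := eqVneq i 0; first by rewrite !normalized_row0.
have [->|j0] := eqVneq j 0; first by rewrite !normalized_col0.
have [->//|i1] := eqVneq i 1.
apply: (@eq_third _ _ (normalized A 1 j)) => //.
- by split; rewrite ?normalized_neq0 ?neq1 ?normalized_inj_col.
- by rewrite row1; split; rewrite ?normalized_neq0 ?neq1 ?normalized_inj_col.
- exact: normalized_neq0.
- exact: neq1.
Qed.

(** The inverse of u differs from u: otherwise u = -1, so F has odd
    characteristic, while v = -v because both avoid 0, 1 and -1. *)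
Lemma invr_of_distinct (u v : F) : (#|F| <= 4)%N ->
  u != 0 -> u != 1 -> v != 0 -> v != 1 -> u != v -> v = u^-1.
Proof.
move=> F4 u0 u1 v0 v1 uv.
apply: (@eq_third _ _ u) => //; first by split; rewrite // eq_sym.
split; rewrite ?invr_eq0 ?invr_eq1 //; apply: contraNneq uv => uu.
have um : u = -1.
  have : (u - 1) * (u + 1) = 0.
    by rewrite -subr_sqr_1 expr2 -{1}uu mulVf // subrr.
  by move/eqP; rewrite mulf_eq0 subr_eq0 (negPf u1) addr_eq0 => /eqP.
rewrite um in u1 *; apply/contraT => uv.
have vv : v = - v.
  apply: (@eq_third _ _ (-1)); rewrite ?oppr_eq0 ?oner_eq0 //.
    by rewrite v0 v1 eq_sym.
  by rewrite v0 eqr_opp v1 eqr_oppLR eq_sym uv.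
case/eqP: u1; apply/esym/(mulIf v0); rewrite mulN1r mul1r.
exact: vv.
Qed.

(** Put both codes in systematic form. Two matrices whose normalized (1, 1)
    entries agree differ by row and column scalings. Otherwise these entries are inverse to each other, and
    exchanging the first two columns of one matrix inverts its entry. *)
Lemma MDS_unique k r (C C' : {vspace 'rV[F]_(k.+2 + r.+2)}) : (#|F| <= 4)%N ->
  MDS C -> \dim C = k.+2 -> MDS C' -> \dim C' = k.+2 ->
  monomially_equivalent C C'.
Proof.
move=> F4 CM dC CM' dC'.
have [A eC] := MDS_syscode dC isT CM; have [A' eC'] := MDS_syscode dC' isT CM'.
move: CM CM'; rewrite {}eC {}eC' => /MDS_small_minors-/(_ isT) Am.
move=> /MDS_small_minors-/(_ isT) Am' {C C' dC dC'}.
have [A0 A2] := Am; have [A0' A2'] := Am'.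
suff [t Bm e] : exists2 t : 'S_r.+2, small_minors_neq0 (col_perm t A) &
    normalized (col_perm t A) 1 1 = normalized A' 1 1.
  have E := eq_normalized F4 Bm Am' e; case: Bm => B0 _.
  set B := col_perm t A in B0 E.
  apply: (@syscode_monomial _ _ _ _ t (fun i => B 0 0 * A' i 0 / (B i 0 * A' 0 0))
     (fun j => A' 0 j / B 0 j)) => [i|j|i j].
  - by rewrite !mulf_neq0 ?invr_neq0 ?mulf_neq0.
  - by rewrite !mulf_neq0 ?invr_neq0.
  have -> : A i (t j) = B i j by rewrite mxE.
  have -> : A' i j = normalized A' i j * (A' i 0 * A' 0 j) / A' 0 0.
    by rewrite /normalized; field; rewrite !A0'.
  by rewrite -E /normalized; field; rewrite ?B0 ?A0'.
have [e|ne] := eqVneq (normalized A 1 1) (normalized A' 1 1).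
  by exists 1%g; rewrite col_perm1.
exists (tperm 0 1).
  split=> [i j|i i' j j' ii jj]; rewrite !mxE //.
  by apply: A2 => //; rewrite (inj_eq perm_inj).
rewrite {1}/normalized !mxE tpermL tpermR.
have n1 B : small_minors_neq0 B -> @normalized k r B 1 1 != 1.
  move=> Bm; rewrite -(normalized_col0 1 Bm).
  by rewrite (inj_eq (normalized_inj_row Bm _)).
rewrite (invr_of_distinct F4 _ _ _ _ ne) ?normalized_neq0 ?n1 //.
by rewrite /normalized; field; rewrite !A0.
Qed.

End Uniqueness.

(** * Reduction to existence, and perfect codes *)

Section Classification.
Variable F : finFieldType.
Hypothesis F4 : #|F| <= 4.

Lemma nontrivial_MDS_dims n (C : {vspace 'rV[F]_n}) : nontrivial_MDS C ->
  exists k r, [/\ n = k.+2 + r.+2, \dim C = k.+2, k.+2 < #|F| & r.+2 < #|F|].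
Proof.
case=> CM /andP[k2 kn].
have [k kE] : {k | \dim C = k.+2 :> nat} by exists (\dim C - 2); rewrite -addn2 subnK.
rewrite kE in kn; have [r nE] : {r | n = k.+2 + r.+2} by exists (n - k - 4); lia.
exists k, r; split=> //; move: C CM kE {k2 kn}; rewrite nE => C CM kE.
  have [A eC] := MDS_syscode kE isT CM; move: CM; rewrite eC.
  by move=> /MDS_small_minors-/(_ isT)/small_minors_tr/small_minors_ltn_card.
have [A eC] := MDS_syscode kE isT CM; move: CM; rewrite eC.
by move=> /MDS_small_minors-/(_ isT)/small_minors_ltn_card.
Qed.

Lemma nontrivial_MDS_equivalent m n
    (C : {vspace 'rV[F]_m}) (D : {vspace 'rV[F]_n}) :
  nontrivial_MDS C -> nontrivial_MDS D -> m = n -> \dim C = \dim D ->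
  equivalent C D.
Proof.
move=> CM [DM _] mn; have [k [r [mE kE _ _]]] := nontrivial_MDS_dims CM.
case: CM => CM _; case: _ / mn D DM => D DM dimE.
exists erefl; subst m; apply: MDS_unique => //.
by rewrite -dimE.
Qed.

End Classification.

Section Hamming.
Local Open Scope ring_scope.
Variable F : finFieldType.

Lemma ord2 (j : 'I_2) : j = 0 \/ j = 1.
Proof. by case: j => [[|[|]]] // h; [left|right]; apply: val_inj. Qed.

(** A syndrome is either supported on one check symbol or proportional to a row
    of A: the k = q - 1 ratios A i 1 / A i 0 are distinct and nonzero, hence
    exhaust the nonzero elements of F. In each case, changing one symbol
    corrects the word. *)
Lemma syscode_perfect k (A : 'M[F]_(k, 2)) :
  #|F| = k.+1 -> small_minors_neq0 A -> hamming_code (syscode A).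
Proof.
move=> Fk Am; have k0 : (0 < k)%N by rewrite -ltnS -Fk finNzRing_gt1.
have [A0 A2] := Am; have AM := small_minors_MDS k0 Am.
have wt := (MDSP (C := syscode A) _).1 AM; rewrite dim_syscode addKn in wt.
have rad : packing_radius (syscode A) = 1%N.
  by rewrite /packing_radius AM dim_syscode addKn.
split=> // x.
suff [u [v [uv xuv]]] : exists u v, (hweight (row_mx u v) <= 1)%N /\
    rsubmx x - lsubmx x *m A = v - u *m A.
  have cC : x - row_mx u v \in syscode A.
    rewrite mem_syscode -[x]hsubmxK opp_row_mx add_row_mx row_mxKl row_mxKr.
    rewrite mulmxBl -[rsubmx x](subrK (lsubmx x *m A)) xuv.
    by rewrite -!addrA addrC -!addrA addNr addr0 addrC.
  have xc : (hdist x (x - row_mx u v) <= 1)%N by rewrite hdistE opprB addrC subrK.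
  exists (x - row_mx u v); rewrite rad; split=> // c [c'C xc'].
  apply/eqP; rewrite -subr_eq0; apply: contraT => cc.
  have := wt k0 _ (rpredB cC c'C) cc; rewrite -hdistE.
  have := hdist_triangle (x - row_mx u v) x c.
  lia.
set s := _ - _; have [s0|s0] := eqVneq (s 0 0) 0.
  exists 0, s; rewrite mul0mx subr0; split=> //.
  rewrite hweight_row_mx hweight0 add0n.
  have := @hweight_leq F _ s [set 1]; rewrite cards1; apply=> j.
  by rewrite inE; case: (ord2 j) => ->.
have [s1|s1] := eqVneq (s 0 1) 0.
  exists 0, s; rewrite mul0mx subr0; split=> //.
  rewrite hweight_row_mx hweight0 add0n.
  have := @hweight_leq F _ s [set 0]; rewrite cards1; apply=> j.
  by rewrite inE; case: (ord2 j) => ->.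
pose g (o : option 'I_k) := if o is Some i then A i 1 / A i 0 else 0.
have g_inj : injective g.
  case=> [i|] [i'|] //= /eqP.
  - rewrite eqr_div // => e; congr Some; apply/eqP; apply: contraTT e => ii.
    by rewrite eq_sym mulrC A2.
  - by rewrite mulf_eq0 invr_eq0 !(negPf (A0 _ _)).
  - by rewrite eq_sym mulf_eq0 invr_eq0 !(negPf (A0 _ _)).
have card_g : (#|F| <= #|{: option 'I_k}|)%N by rewrite card_option card_ord Fk.
have /codomP[[i|] gE] := inj_card_onto g_inj card_g (s 0 1 / s 0 0); last first.
  by move/eqP: gE; rewrite /= mulf_eq0 invr_eq0 (negPf s0) (negPf s1).
exists (- (s 0 0 / A i 0) *: delta_mx 0 i), 0; split.
  rewrite hweight_row_mx hweight0 addn0.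
  have := @hweight_leq F _ (- (s 0 0 / A i 0) *: delta_mx 0 i) [set i].
  rewrite cards1; apply=> l.
  by rewrite inE => /negPf li; rewrite !mxE li mulr0.
rewrite sub0r -scalemxAl -rowE -scaleNr opprK; apply/rowP => j.
rewrite [RHS]mxE [row i A _ _]mxE; case: (ord2 j) => ->; first by rewrite divfK.
have -> : s 0 1 = s 0 1 / s 0 0 * s 0 0 by rewrite divfK.
by rewrite gE /=; field; apply: A0.
Qed.

End Hamming.

(** * The codes over the fields of order 3 and 4 *)

Section Ternary.
Local Open Scope ring_scope.
Variable F : finFieldType.

(** The matrix with rows (1, 1) and (1, -1). *)
Definition ternary_mx : 'M[F]_2 := \matrix_(i, j) (-1) ^+ (i * j).

Hypothesis F3 : #|F| = 3.

(** From 2^3 = 2, either 2 = 0 or 3 = 0; in characteristic 2 the polynomial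
    X^3 - X = X (X - 1)^2 would have only the roots 0 and 1. *)
Lemma ternary_char : (3%:R : F) = 0.
Proof.
have : (2%:R : F) * 3%:R = 0.
  have := expf_card (2%:R : F); rewrite F3 => e.
  have -> : (2%:R : F) * 3%:R = 2%:R ^+ 3 - 2%:R by ring.
  by rewrite e subrr.
move/eqP; rewrite mulf_eq0 => /orP[/eqP two|/eqP//].
have [x] : exists x, x \in ~: [set 0; 1 : F].
  apply/card_gt0P; have := cardsC [set 0; 1 : F].
  by rewrite F3 cards2; case: #|_|; case: (_ != _).
rewrite !inE negb_or => /andP[x0 x1].
have := expf_card x; rewrite F3 => e.
have : x * (x - 1) ^+ 2 = 0.
  have -> : x * (x - 1) ^+ 2 = x ^+ 3 - x - 2%:R * x ^+ 2 + 2%:R * x by ring.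
  by rewrite e two; ring.
by move/eqP; rewrite mulf_eq0 expf_eq0 subr_eq0 (negPf x0) (negPf x1).
Qed.

Lemma ternary_opp1 : (-1 : F) != 1.
Proof.
rewrite eq_sym -subr_eq0 opprK; apply: contra_eq_neq ternary_char => two.
have -> : (3%:R : F) = 1 + (1 + 1) by ring.
by rewrite two addr0 oner_eq0.
Qed.

Lemma ternary_minors : small_minors_neq0 ternary_mx.
Proof.
split=> [i j|i i' j j']; rewrite !mxE; first by rewrite expf_neq0 // oppr_eq0 oner_eq0.
case: (ord2 i) => ->; case: (ord2 i') => ->;
  case: (ord2 j) => ->; case: (ord2 j') => -> // _ _.
all: by rewrite /= ?muln0 ?expr0 ?expr1 ?mul1r ?mulr1 // ?(eq_sym 1) ternary_opp1.
Qed.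

Lemma ternary_self_dual : self_dual (syscode ternary_mx).
Proof.
apply: self_dual_syscode; apply/matrixP => i j; rewrite !mxE big_ord_recl big_ord1 !mxE.
have c := ternary_char.
case: (ord2 i) => ->; case: (ord2 j) => -> /=; rewrite ?mulr1n ?mulr0n ?expr0 ?expr1.
all: by [ring | rewrite -[RHS]add0r -c; ring].
Qed.

End Ternary.

Lemma syscode_span (F : finFieldType) k r (A : 'M[F]_(k, r)) :
  syscode A = <<[seq row i (row_mx 1%:M A)%R | i <- enum 'I_k]>>%VS.
Proof.
apply/eqP; rewrite eqEsubv; apply/andP; split; last first.
  apply/span_subvP => _ /mapP[i _ ->].
  by rewrite rowE mul_mx_row mulmx1 syscode_row.
apply/subvP => y; rewrite mem_syscode => /eqP yA.
have -> : y = (lsubmx y *m row_mx 1%:M A)%R.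
  by rewrite mul_mx_row mulmx1 -yA hsubmxK.
rewrite mulmx_sum_row; apply: memv_suml => i _; apply: memvZ; apply: memv_span.
by apply/mapP; exists i; rewrite ?mem_enum.
Qed.

Section Quaternary.
Local Open Scope ring_scope.
Variable F : finFieldType.

(** (-1)^4 = -1 gives 1 + 1 = 0, and X^4 - X = X (X - 1) (X^2 + X + 1) in
    characteristic 2, so every element other than 0 and 1 is a root of the
    last factor. *)
Lemma quaternary_root : #|F| = 4 ->
  exists w : F, [/\ w != 0, w != 1, w ^+ 2 = w + 1 & (1 + 1 : F) = 0].
Proof.
move=> F4; have two : (1 + 1 : F) = 0.
  have := expf_card (-1 : F); rewrite F4 => e.
  have -> : (1 + 1 : F) = (-1) ^+ 4 - (-1) by ring.
  by rewrite e subrr.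
have [x] : exists x, x \in ~: [set 0; 1 : F].
  apply/card_gt0P; have := cardsC [set 0; 1 : F].
  by rewrite F4 cards2; case: #|_|; case: (_ != _).
rewrite !inE negb_or => /andP[x0 x1]; exists x; split=> //.
have := expf_card x; rewrite F4 => e.
have : x * (x - 1) * (x ^+ 2 - x - 1) = 0.
  have -> : x * (x - 1) * (x ^+ 2 - x - 1) =
      x ^+ 4 - x + (1 + 1) * (x - x ^+ 3) by ring.
  by rewrite e two mul0r subrr addr0.
move/eqP; rewrite !mulf_eq0 (negPf x0) subr_eq0 (negPf x1) /= -addrA -opprD subr_eq0.
by move/eqP.
Qed.

Variable w : F.
Hypotheses (w0 : w != 0) (w1 : w != 1) (w2 : w ^+ 2 = w + 1).
Hypothesis two : (1 + 1 : F) = 0.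

(** The values of x^2, x and 1 at w^0, ..., w^(r-1). *)
Definition quadratic_mx r : 'M[F]_(3, r) := \matrix_(i, j) w ^+ ((2 - i) * j).

(** The matrix with rows (w, w^2) and (w^2, w), orthogonal in characteristic 2
    because w + w^2 = 1 and w^4 = w. *)
Definition self_dual_mx : 'M[F]_2 := \matrix_(i, j) w ^+ (1 + (i != j)).

Lemma quadratic_minors : small_minors_neq0 (quadratic_mx 2).
Proof.
split=> [i j|i i' j j']; rewrite !mxE; first by rewrite expf_neq0.
have ww : w ^+ 2 != w.
  by rewrite expr2 -subr_eq0 -{3}[w]mulr1 -mulrBr mulf_neq0 // subr_eq0.
have w21 : w ^+ 2 != 1 by rewrite w2 -subr_eq0 addrK.
case: (ord2 j) => ->; case: (ord2 j') => -> // + _;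
  rewrite /= !muln0 !muln1 expr0 ?mul1r ?mulr1.
all: case: i => [[|[|[|//]]] ?]; case: i' => [[|[|[|//]]] ?] //= _.
all: by rewrite ?expr0 ?expr1 // eq_sym.
Qed.

Lemma self_dual_minors : small_minors_neq0 self_dual_mx.
Proof.
split=> [i j|i i' j j']; rewrite !mxE; first by rewrite expf_neq0.
have ww : w ^+ 2 * w ^+ 2 != w * w.
  rewrite -expr2 -subr_eq0 -exprM (_ : _ - _ = w ^+ 2 * ((w - 1) * (w + 1))); last ring.
  by rewrite -w2 !mulf_neq0 ?expf_neq0 // subr_eq0.
case: (ord2 i) => ->; case: (ord2 i') => ->;
  case: (ord2 j) => ->; case: (ord2 j') => -> // _ _.
all: by rewrite /= ?expr1 // eq_sym.
Qed.

Lemma quaternary_self_dual : self_dual (syscode self_dual_mx).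
Proof.
have diag : w * w + w ^+ 2 * w ^+ 2 = -1.
  have -> : -1 = -1 + (1 + 1) * (w * w + w + 1) :> F by rewrite two mul0r addr0.
  by rewrite w2; ring.
have off : w * w ^+ 2 + w ^+ 2 * w = 0.
  have -> : w * w ^+ 2 + w ^+ 2 * w = (1 + 1) * (w * w ^+ 2) by ring.
  by rewrite two mul0r.
apply: self_dual_syscode; apply/matrixP => i j; rewrite !mxE big_ord_recl big_ord1 !mxE.
case: (ord2 i) => ->; case: (ord2 j) => -> /=.
all: by rewrite ?mulr1n ?mulr0n ?oppr0 ?addn0 ?expr1 // addrC.
Qed.

Lemma hexacode_syscode : hexacode_at w = syscode (quadratic_mx 3).
Proof.
pose G := row_mx 1%:M (quadratic_mx 3).
have rowG (i : 'I_3) (s : seq F) :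
    (forall j : 'I_3, s`_j = (i == j)%:R) ->
    (forall j : 'I_3, s`_(3 + j) = w ^+ ((2 - i) * j)) ->
  row_of_seq 6 s = row i G.
  move=> sl sr; apply/rowP => j; rewrite !mxE.
  by case: splitP => j' ->; rewrite ?sl ?sr mxE.
have w3 : w ^+ 3 = 1 by rewrite exprS w2; ring: w2 two.
have w4 : w ^+ 4 = w by rewrite exprS w3 mulr1.
have r0 : row_of_seq 6 [:: 1; 0; 0; 1; w ^+ 2; w] = row 0 G.
  by apply: rowG; case=> [[|[|[|]]]].
have r1 : row_of_seq 6 [:: 0; 1; 0; 1; w; w ^+ 2] = row 1 G.
  by apply: rowG; case=> [[|[|[|]]]].
have r2 : row_of_seq 6 [:: 0; 0; 1; 1; 1; 1] = row ord_max G.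
  by apply: rowG; case=> [[|[|[|]]]].
have enum3 : enum 'I_3 = [:: 0; 1; ord_max].
  by apply: (inj_map val_inj); rewrite val_enum_ord.
by rewrite syscode_span enum3 /hexacode_at r0 r1 r2.
Qed.

(** The symbols of a hexacode word are a, b, c and the values at 1, w and w^2 of
    f(x) = a x^2 + b x + c. In the sum of f(x)^3 over the cube roots of unity,
    only the monomials a^3, b^3, c^3 and abc survive, with coefficients 3, 3, 3
    and 18; adding the cubes of a, b and c makes all of them even.
    The sums are right-nested and end in 0, the shape in which big_ord_recl
    unfolds them. *)
Lemma sum_cubes a b c :
  a ^+ 3 + (b ^+ 3 + (c ^+ 3 + 0)) +
  ((a * 1 + (b * 1 + (c * 1 + 0))) ^+ 3 +
   ((a * w ^+ 2 + (b * w ^+ 1 + (c * w ^+ 0 + 0))) ^+ 3 +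
    ((a * w ^+ 4 + (b * w ^+ 2 + (c * w ^+ 0 + 0))) ^+ 3 + 0))) = 0.
Proof.
have q : w ^+ 2 = - w - 1.
  by rewrite -[RHS]addr0 -[X in _ + X](mul0r (w + 1)) -two w2; ring.
transitivity ((1 + 1) * (2 * (a ^+ 3 + b ^+ 3 + c ^+ 3) + 9 * (a * b * c))).
  by ring: q.
by rewrite two mul0r.
Qed.

Hypothesis F4 : #|F| = 4%N.

(** The first five symbols form a nonzero word of an MDS code with minimum
    distance 3, and the sum of the cubes makes the weight even. *)
Lemma hweight_hexacode x : x != 0 ->
  hweight (row_mx x (x *m quadratic_mx 3)) = 4 \/
  hweight (row_mx x (x *m quadratic_mx 3)) = 6%N.
Proof.
move=> x0; set y := row_mx _ _.
have w_ge3 : (3 <= hweight y)%N.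
  have M := small_minors_MDS (isT : (0 < 3)%N) quadratic_minors.
  have := (MDSP (C := syscode (quadratic_mx 2)) _).1 M _ (syscode_row _ x).
  rewrite dim_syscode addKn => /(_ isT) M'; apply: leq_trans (M' _) _.
    apply: contraNneq x0 => e; apply/eqP.
    by rewrite -[LHS](row_mxKl x (x *m quadratic_mx 2)) e linear0.
  rewrite !hweight_row_mx leq_add2l !hweightE [leqRHS]big_ord_recr /= -[leqLHS]addn0.
  apply: leq_add => //; apply: eq_leq; apply: eq_bigr => i _.
  by congr (nat_of_bool (_ != _)); rewrite !mxE; apply: eq_bigr => l _; rewrite !mxE.
have cube (z : F) : (z != 0)%:R = z ^+ 3.
  have [->|z0] := eqVneq z 0; first by rewrite expr0n.
  by apply: (mulfI z0); rewrite mulr1 -exprS -F4 expf_card.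
have wpar : ~~ odd (hweight y).
  have h0 : (hweight y)%:R = 0 :> F.
    rewrite hweightE natr_sum; under eq_bigr do rewrite cube.
    rewrite big_split_ord /=.
    under eq_bigr do rewrite row_mxEl.
    under [X in _ + X]eq_bigr do rewrite row_mxEr mxE.
    rewrite !big_ord_recl !big_ord0 !mxE /=.
    move: (x 0 ord0) (x 0 _) (x 0 _) => a b c; rewrite !muln0 !expr0.
    exact: sum_cubes.
  apply: contra_eqN h0 => o.
  rewrite -[hweight y]odd_double_half o natrD -muln2 natrM.
  by rewrite (_ : 2%:R = 0 :> F) // mulr0 addr0 oner_eq0.
have := hweight_zeros y.
move: wpar w_ge3; case: (hweight y) => [|[|[|[|[|[|[|m]]]]]]] //; [by left|by right].
Qed.

End Quaternary.

(** * The hexacode and the classification *)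

Section Hexacode.
Local Open Scope ring_scope.
Variables (F : finFieldType) (w : F).
Hypotheses (w0 : w != 0) (w1 : w != 1) (w2 : w ^+ 2 = w + 1).
Hypotheses (two : (1 + 1 : F) = 0) (F4 : #|F| = 4%N).

Lemma hexacode_word_weight y : y \in syscode (quadratic_mx w 3) -> y != 0 ->
  hweight y = 4 \/ hweight y = 6%N.
Proof.
rewrite mem_syscode => /eqP yA y0; move: y0; rewrite -[y]hsubmxK yA => y0.
apply: hweight_hexacode => //; apply: contraNneq y0 => ->.
by rewrite mul0mx row_mx0.
Qed.

Lemma hexacode_MDS : MDS (syscode (quadratic_mx w 3)).
Proof.
apply/MDSP; rewrite dim_syscode // => y yC y0.
by case: (hexacode_word_weight yC y0) => ->.
Qed.

(** Weight 4 is attained by the word of f = 1, and weight 6 by that of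
    f = x^2 + x + w, whose nonzero values are w, w^2 and w^2. *)
Lemma hexacode_two_weight : two_weight (syscode (quadratic_mx w 3)).
Proof.
exists 4, 6%N; split=> // d; split=> [[y yC [y0 <-]]|].
  exact: hexacode_word_weight.
have w20 : w ^+ 2 != 0 by rewrite expf_neq0.
have word x : x != 0 -> exists2 y, y \in syscode (quadratic_mx w 3) &
    y != 0 /\ hweight y = hweight (row_mx x (x *m quadratic_mx w 3)).
  move=> x0; exists (row_mx x (x *m quadratic_mx w 3)); first exact: syscode_row.
  split=> //; apply: contraNneq x0 => e; apply/eqP.
  by rewrite -[LHS](row_mxKl x (x *m quadratic_mx w 3)) e linear0.
case=> ->.
  have x0 : delta_mx 0 ord_max != 0 :> 'rV[F]_3.
    by apply/eqP => /rowP/(_ ord_max)/eqP; rewrite !mxE !eqxx oner_eq0.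
  have [y yC [y0 yw]] := word _ x0; exists y => //; split=> //.
  rewrite yw -rowE hweight_row_mx !hweightE !big_ord_recl !big_ord0 !mxE /=.
  by rewrite !expr0 oner_eq0 eqxx.
pose x : 'rV[F]_3 := \row_i (if i == ord_max then w else 1).
have x0 : x != 0.
  by apply/eqP => /rowP/(_ 0)/eqP; rewrite !mxE oner_eq0.
have [y yC [y0 yw]] := word _ x0; exists y => //; split=> //.
have ww : w + w = 0 by rewrite -[w]mul1r -mulrDl two mul0r.
have fw : w ^+ 2 + (w ^+ 1 + w) = w ^+ 2 by rewrite expr1 ww addr0.
have fw2 : w ^+ 4 + (w ^+ 2 + w) = w ^+ 2.
  by rewrite -F4 expf_card addrCA ww addr0.
rewrite yw hweight_row_mx !hweightE !big_ord_recl !big_ord0 !mxE /=.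
rewrite !big_ord_recl !big_ord0 !mxE /= !muln0 !expr0 !mul1r !mulr1 !addr0.
rewrite addrA two add0r w0 oner_eq0.
by rewrite fw fw2 w20.
Qed.

End Hexacode.
Theorem mainTheorem7 (F : finFieldType) :
  [/\ (#|F| = 2 ->
        forall (n : nat) (C : {vspace 'rV[F]_n}), ~ nontrivial_MDS C),
      (#|F| = 3 ->
        exists T : {vspace 'rV[F]_4},
          [/\ hamming_code T, code_params T 2 3, self_dual T &
              forall (n : nat) (C : {vspace 'rV[F]_n}),
                nontrivial_MDS C <-> equivalent C T])
    & (#|F| = 4 ->
        exists (H : {vspace 'rV[F]_5}) (D : {vspace 'rV[F]_4})
               (X : {vspace 'rV[F]_6}),
          [/\ hamming_code H /\ code_params H 3 3,
              simplex_code (dual H) /\ code_params (dual H) 2 4,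
              self_dual D /\ code_params D 2 3,
              [/\ hexacode X, two_weight X & code_params X 3 4] &
              ~ equivalent H (dual H) /\
              forall (n : nat) (C : {vspace 'rV[F]_n}),
                nontrivial_MDS C <->
                [\/ equivalent C H, equivalent C (dual H),
                    equivalent C D | equivalent C X]])].
Proof.
split=> cF.
- move=> n C /nontrivial_MDS_dims; rewrite cF => -[//|k [r [_ _]]].
  by [].
- have Tm := ternary_minors cF; have TM := small_minors_MDS (isT : 0 < 2) Tm.
  have dT := dim_syscode (ternary_mx F).
  exists (syscode (ternary_mx F)); split.
  + exact: (syscode_perfect cF Tm).
  + by split=> //; rewrite TM dT.
  + exact: (ternary_self_dual cF).
  have TN : nontrivial_MDS (syscode (ternary_mx F)) by split=> //; rewrite dT.
  move=> n C; split=> [CN|]; last exact: equivalent_nontrivial.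
  have [|k [r [nE kE kF rF]]] := nontrivial_MDS_dims _ CN; first by rewrite cF.
  rewrite cF in kF rF; case: k kE nE kF => // kE nE _; case: r rF nE => // _ nE.
  by apply: nontrivial_MDS_equivalent; rewrite ?cF ?dT.
have [w [w0 w1 w2 two]] := quaternary_root cF.
have Hm := quadratic_minors w0 w1 w2; have HM := small_minors_MDS (isT : 0 < 3) Hm.
have Dm := self_dual_minors w0 w1 w2; have DM := small_minors_MDS (isT : 0 < 2) Dm.
have XM := hexacode_MDS w0 w1 w2 two cF.
set H := syscode (quadratic_mx w 2) in HM *.
set D := syscode (self_dual_mx w) in DM *.
set X := syscode (quadratic_mx w 3) in XM *.
have dH : \dim H = 3 := dim_syscode _.
have dD : \dim D = 2 := dim_syscode _.
have dX : \dim X = 3 := dim_syscode _.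
have dS : \dim (dual H) = 2 := dim_dual_syscode _.
have SM : MDS (dual H).
  apply/MDSP; rewrite dS // => y yS y0.
  by have := MDS_dual_weight _ HM yS y0; rewrite dH; apply.
have HN : nontrivial_MDS H by split=> //; rewrite dH.
have SN : nontrivial_MDS (dual H) by split=> //; rewrite dS.
have DN : nontrivial_MDS D by split=> //; rewrite dD.
have XN : nontrivial_MDS X by split=> //; rewrite dX.
have HH : hamming_code H by exact: (syscode_perfect cF Hm).
exists H, D, X; split.
- by split=> //; split=> //; rewrite HM dH.
- by split; [exists H|split=> //; rewrite SM dS].
- by split; [apply: quaternary_self_dual|split=> //; rewrite DM dD].
- split; last by split=> //; rewrite XM dX.
    exists w; last by rewrite hexacode_syscode.
    by rewrite w2 -[RHS](mul0r (w + 1)%R) -two; ring.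
  exact: hexacode_two_weight.
split=> [/equivalent_params[_]|n C]; first by rewrite dH dS.
split=> [CN|[]]; try exact: equivalent_nontrivial.
have F4 : #|F| <= 4 by rewrite cF.
have [k [r [nE kE kF rF]]] := nontrivial_MDS_dims F4 CN.
rewrite cF in kF rF.
case: k kE nE kF => [|[|//]] kE nE _; case: r rF nE => [|[|//]] _ nE.
- by apply: Or43; apply: nontrivial_MDS_equivalent; rewrite ?dD.
- by apply: Or42; apply: nontrivial_MDS_equivalent; rewrite ?dS.
- by apply: Or41; apply: nontrivial_MDS_equivalent; rewrite ?dH.
- by apply: Or44; apply: nontrivial_MDS_equivalent; rewrite ?dX.
Qed.
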